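(* Let $A$ be a binary matrix (all entries in $\{0,1\}$) with $n$ columns, and let $$Q^\ast(A)=\operatorname{conv}(\{x\in\mathbb{Z}^n\mid Ax\ge\mathbf{1},\ x\ge\mathbf{0}\}),\qquad \overline{Q^\ast(A)}=\operatorname{conv}(\{x\in\mathbb{Z}^n\mid Ax\ge\mathbf{1},\ \mathbf{1}\ge x\ge\mathbf{0}\}).$$ Then two distinct vertices of $Q^\ast(A)$ are adjacent in $Q^\ast(A)$ if and only if they are adjacent in $\overline{Q^\ast(A)}$.
   Context: $\mathbf{0}$ and $\mathbf{1}$ denote vectors of appropriate dimension with all components equal to $0$ and to $1$, respectively; vector inequalities are component-wise; $\operatorname{conv}(X)$ is the convex hull of $X\subset\mathbb{R}^n$. Two distinct vertices $\xi,\eta$ of a polyhedron $S\subset\mathbb{R}^n$ are adjacent in $S$ if there exist $c\in\mathbb{R}^n$ and $b\in\mathbb{R}$ such that $c\cdot x\ge b$ for all $x\in S$, with equality if and only if $x$ belongs to the closed segment $[\xi,\eta]$ (that is, $[\xi,\eta]$ is an edge of $S$). *)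

(* Defs.v *)
From HB Require Import structures.
From mathcomp Require Import all_boot all_order all_algebra.
From mathcomp Require Import classical_sets reals convex.

Set Implicit Arguments.
Unset Strict Implicit.
Unset Printing Implicit Defensive.

Import Order.TTheory GRing.Theory Num.Theory.

Local Open Scope classical_set_scope.
Local Open Scope ring_scope.

Definition mxle (R : realType) (m n : nat) (u v : 'M[R]_(m, n)) : Prop :=
  forall i j, u i j <= v i j.

Notation "u <=m v" := (mxle u v) (at level 70, no associativity) : ring_scope.

Definition dotcv (R : realType) (n : nat) (c x : 'cV[R]_n) : R :=
  \sum_i c i 0 * x i 0.

Definition binary_mx (R : realType) (m n : nat) (A : 'M[R]_(m, n)) : Prop :=
  forall i j, A i j = 0 \/ A i j = 1.

(* The points of Z^n, seen inside R^n. *)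
Definition integral_cv (R : realType) (n : nat) (x : 'cV[R]_n) : Prop :=
  forall i, x i 0 \is a Num.int.

Definition conv_hull (R : realType) (n : nat) (X : set 'cV[R]_n) :
  set 'cV[R]_n := smallest (@convex_set R 'cV[R]_n) X.

Definition closed_segment (R : realType) (n : nat) (xi eta : 'cV[R]_n) :
  set 'cV[R]_n :=
  [set x | exists2 t : R, 0 <= t <= 1 & x = (1 - t) *: xi + t *: eta].

(* The inequality c . x >= b is valid on S, and among the points of S it is
   tight exactly at those in F. *)
Definition supports (R : realType) (n : nat) (S F : set 'cV[R]_n)
    (c : 'cV[R]_n) (b : R) : Prop :=
  forall x, S x -> b <= dotcv c x /\ (dotcv c x = b <-> F x).

(* A vertex is a 0-dimensional face; for a polyhedron these are exactly the
   extreme points. *)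
Definition vertex (R : realType) (n : nat) (S : set 'cV[R]_n)
    (v : 'cV[R]_n) : Prop :=
  S v /\ exists c b, supports S [set v] c b.

Definition adjacent (R : realType) (n : nat) (S : set 'cV[R]_n)
    (xi eta : 'cV[R]_n) : Prop :=
  [/\ vertex S xi, vertex S eta, xi <> eta &
      exists c b, supports S (closed_segment xi eta) c b].

Definition Qstar (R : realType) (m n : nat) (A : 'M[R]_(m, n)) :
  set 'cV[R]_n :=
  conv_hull [set x | [/\ integral_cv x, const_mx 1 <=m A *m x &
                         const_mx 0 <=m x]].

Definition Qstar_bar (R : realType) (m n : nat) (A : 'M[R]_(m, n)) :
  set 'cV[R]_n :=
  conv_hull [set x | [/\ integral_cv x, const_mx 1 <=m A *m x,
                         x <=m const_mx 1 & const_mx 0 <=m x]].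

(* Main.v *)
Require Import Defs.
From mathcomp Require Import all_boot all_order all_algebra.
From mathcomp Require Import boolp classical_sets reals convex.
From mathcomp Require Import interval_inference ring lra.

(** The integer points [x >= 0] with [A x >= 1] ("covers") are closed under
    enlarging the support, so every vertex of [Qstar A] is a minimal cover and
    in particular a 0/1 vector.  Restricting a supporting functional from
    [Qstar A] to [Qstar_bar A] is immediate.  Conversely let [c . x >= b]
    expose the edge [[xi, eta]] of [Qstar_bar A] and let [J] be the set of [j] with [c_j <= 0].
    By minimality of [xi] and [eta], [J] lies in both supports, so replacing
    [c_j] by a small [eps > 0] for [j] in [J] and shifting [b] accordingly keeps
    [xi] and [eta] tight.  For a cover [x], the 0/1 cover [x'] which is [1] on
    [J] and [min (x_j, 1)] elsewhere satisfies
    [c' . x - b' = (c . x' - b) + \sum_j c'_j (x_j - x'_j)];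
    either [x'] is off the edge and the first term dominates the at most
    [n] losses of [eps], or [x'] is [xi] or [eta] and minimality forces
    [x' <= x]. *)

Set Implicit Arguments.
Unset Strict Implicit.
Unset Printing Implicit Defensive.

Import Order.TTheory GRing.Theory Num.Theory.

Local Open Scope classical_set_scope.
Local Open Scope ring_scope.

Lemma int_gt0_ge1 (R : realType) (x : R) : x \is a Num.int -> 0 < x -> 1 <= x.
Proof. by move=> xi x0; rewrite -(gtr0_norm x0) norm_intr_ge1// gt_eqF. Qed.

Lemma finite_pos_lower_bound (R : realType) (T : finType) (P : T -> Prop)
    (f : T -> R) :
  (forall t, P t -> 0 < f t) ->
  exists2 d, 0 < d & forall t, P t -> d <= f t.
Proof.
(* The starting value 1 keeps the minimum positive even if no [t] satisfies [P]. *)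
move=> f_gt0; exists (\big[Num.min/1]_(t | `[< P t >]) f t).
  by apply: lt_bigmin => // t /asboolP /f_gt0.
by move=> t Pt; apply: bigmin_le_cond; apply/asboolP.
Qed.

(** * Convex hulls, supporting inequalities and segments *)

Section Polyhedra.
Variables (R : realType) (n : nat).
Implicit Types (c x y xi eta : 'cV[R]_n) (X Y F S T : set 'cV[R]_n) (b : R).

Lemma dotcvD c x y : dotcv c (x + y) = dotcv c x + dotcv c y.
Proof.
by rewrite /dotcv -big_split; apply: eq_bigr => i _; rewrite mxE mulrDr.
Qed.

Lemma dotcvZ c t x : dotcv c (t *: x) = t * dotcv c x.
Proof.
by rewrite /dotcv mulr_sumr; apply: eq_bigr => i _; rewrite mxE mulrCA.
Qed.

Lemma dotcv_delta c j : dotcv c (delta_mx j 0) = c j 0.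
Proof.
rewrite /dotcv (bigD1 j)//= mxE !eqxx mulr1 big1 ?addr0// => i ij.
by rewrite mxE (negbTE ij) mulr0.
Qed.

(** Convexity with plain real weights instead of the bundled ones of [convex_set], so that
    arithmetic tactics apply. *)
Definition segment_convex F := forall x y (t : R), F x -> F y -> 0 <= t <= 1 ->
  F (t *: x + (1 - t) *: y).

Lemma sub_conv_hull X : X `<=` conv_hull X.
Proof. exact: sub_gen_smallest. Qed.

Lemma conv_hull_min X F : segment_convex F -> X `<=` F -> conv_hull X `<=` F.
Proof.
move=> cvxF; apply: smallest_sub => x y t; rewrite !inE => Fx Fy.
by apply: cvxF => //; rewrite ge0 le1.
Qed.

Lemma conv_hull_sub X Y : X `<=` Y -> conv_hull X `<=` conv_hull Y.
Proof.
by move=> XY x hx M [cM YM]; apply: hx; split=> // y /XY /YM.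
Qed.

(** A proper convex combination of values at least [b] equals [b] only if both values do, so the
    property is stable under segments and passes from [X] to its hull. *)
Lemma conv_hull_valid X F c b : segment_convex F ->
  (forall x, X x -> b <= dotcv c x /\ (dotcv c x = b -> F x)) ->
  forall x, conv_hull X x -> b <= dotcv c x /\ (dotcv c x = b -> F x).
Proof.
move=> cvxF XF x hx.
pose G := [set y | b <= dotcv c y /\ (dotcv c y = b -> F y)].
suff : G x by [].
move: x hx; apply: conv_hull_min => // x y t [bx Fx] [bY Fy] /andP[t0 t1].
rewrite /G/= dotcvD !dotcvZ; split; first by nra.
move=> e.
(* A zero weight leaves the value at its point unconstrained, hence the separate cases. *)
have [t_0|tn0] := eqVneq t 0.
  move: e; rewrite t_0 subr0 mul0r mul1r scale0r scale1r !add0r.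
  exact: Fy.
have [t_1|tn1] := eqVneq t 1.
  move: e; rewrite t_1 subrr mul0r mul1r scale0r scale1r !addr0.
  exact: Fx.
have tp : 0 < t by rewrite lt_neqAle eq_sym tn0.
have tp' : 0 < 1 - t by rewrite subr_gt0 lt_neqAle tn1.
by apply: cvxF; [apply: Fx|apply: Fy|rewrite t0]; nra.
Qed.

Lemma closed_segment_convex xi eta : segment_convex (closed_segment xi eta).
Proof.
move=> _ _ t [u u01 ->] [v v01 ->] t01.
exists (t * u + (1 - t) * v); first by apply/andP; split; nra.
by apply/matrixP => i j; rewrite !mxE; ring.
Qed.

Lemma closed_segmentl xi eta : closed_segment xi eta xi.
Proof. by exists 0; rewrite ?lexx ?ler01// subr0 scale1r scale0r addr0. Qed.

Lemma closed_segmentr xi eta : closed_segment xi eta eta.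
Proof. by exists 1; rewrite ?lexx ?ler01// subrr scale1r scale0r add0r. Qed.

Lemma supports_conv_hull X xi eta c b :
  dotcv c xi = b -> dotcv c eta = b ->
  (forall x, X x ->
     b <= dotcv c x /\ (dotcv c x = b -> closed_segment xi eta x)) ->
  supports (conv_hull X) (closed_segment xi eta) c b.
Proof.
move=> cxi ceta /(conv_hull_valid (@closed_segment_convex xi eta)) hX x /hX.
move=> [bx Fx]; split=> //; split=> // -[t _ ->].
by rewrite dotcvD !dotcvZ cxi ceta; ring.
Qed.

Lemma supports_sub S T F c b : T `<=` S -> supports S F c b ->
  supports T F c b.
Proof. by move=> sub hS x /sub; exact: hS. Qed.

Lemma vertex_sub S T v : T `<=` S -> T v -> vertex S v -> vertex T v.
Proof.
move=> sub Sv [_ [c [b hc]]]; split=> //; exists c, b.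
exact: supports_sub hc.
Qed.

(** Otherwise the inequality exposing [v] would be strict on [X], hence on the hull (the empty face
    in [conv_hull_valid]), yet it is tight at [v]. *)
Lemma vertex_conv_hull X v : vertex (conv_hull X) v -> X v.
Proof.
move=> [hv [c [b hc]]]; have [_ [_ /(_ erefl) cv]] := hc _ hv.
apply: contrapT => nXv.
have valid x : X x -> b <= dotcv c x /\ (dotcv c x = b -> False).
  move=> Xx; have [bx [eqx _]] := hc x (sub_conv_hull Xx).
  by split=> // /eqx xv; apply: nXv; rewrite -xv.
have cvx0 : segment_convex set0 by [].
by have [_ /(_ cv)] := conv_hull_valid cvx0 valid hv.
Qed.

(** At a coordinate where [xi] and [eta] differ, [x] has entry [t] or [1 - t], so [t] is 0 or 1. *)
Lemma closed_segment_01 xi eta x : xi <> eta ->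
  (forall i, xi i 0 = 0 \/ xi i 0 = 1) ->
  (forall i, eta i 0 = 0 \/ eta i 0 = 1) ->
  (forall i, x i 0 = 0 \/ x i 0 = 1) ->
  closed_segment xi eta x -> x = xi \/ x = eta.
Proof.
move=> ne xi01 eta01 x01 [t t01 xE].
have [i nei] : exists i, xi i 0 <> eta i 0.
  apply: contrapT => /forallNP h; apply: ne; apply/matrixP => i j.
  by rewrite ord1; apply: contrapT => /h.
have xiE : x i 0 = (1 - t) * xi i 0 + t * eta i 0 by rewrite xE !mxE.
have [t0|t1] : t = 0 \/ t = 1.
  by case: (xi01 i) (eta01 i) (x01 i) nei xiE => -> [] -> [] -> ? ?;
    try (by []); try (left; lra); right; lra.
- by left; rewrite xE t0 subr0 scale1r scale0r addr0.
- by right; rewrite xE t1 subrr scale1r scale0r add0r.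
Qed.

End Polyhedra.

(** * Covers, their minimality, and the perturbed functional *)

Section Covers.
Variables (R : realType) (m n : nat) (A : 'M[R]_(m, n)).
Hypothesis hA : binary_mx A.
Implicit Types (c x y xi eta : 'cV[R]_n) (J : pred 'I_n).

Definition cover : set 'cV[R]_n :=
  [set x | [/\ integral_cv x, const_mx 1 <=m A *m x & const_mx 0 <=m x]].

Definition cover01 : set 'cV[R]_n :=
  [set x | [/\ integral_cv x, const_mx 1 <=m A *m x,
               x <=m const_mx 1 & const_mx 0 <=m x]].

Definition minimal_cover x :=
  cover x /\ forall y, cover y -> y <=m x -> y = x.

Lemma cover01_cover : cover01 `<=` cover.
Proof. by move=> x []. Qed.

Lemma cover_ge0 x i : cover x -> 0 <= x i 0.
Proof. by move=> [_ _ /(_ i 0)]; rewrite mxE. Qed.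

Lemma cover01P x i : cover01 x -> x i 0 = 0 \/ x i 0 = 1.
Proof.
move=> [xint _ /(_ i 0) x1 /(_ i 0) x0]; rewrite !mxE in x0 x1.
have [->|xn0] := eqVneq (x i 0) 0; [by left|right].
apply/eqP; rewrite eq_le x1 int_gt0_ge1 ?xint//.
by rewrite lt_neqAle eq_sym xn0.
Qed.

(** Each row is already covered by a single column with [A i j = 1] and [1 <= x j 0], as [A] is
    binary and [x] integral; the other terms only help. *)
Lemma cover_support x y : cover x -> integral_cv y -> const_mx 0 <=m y ->
  (forall j, 1 <= x j 0 -> 1 <= y j 0) -> cover y.
Proof.
move=> [xint Ax x0] yint y0 xy; split=> // i k; rewrite ord1 !mxE {k}.
have term0 j : 0 <= A i j * y j 0.
  by have := y0 j 0; rewrite mxE; case: (hA i j) => ->; lra.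
have [j [Aij xj]] : exists j, A i j = 1 /\ 1 <= x j 0.
  apply: contrapT => /forallNP h; have := Ax i 0; rewrite !mxE big1 ?ler10//.
  move=> j _; case: (hA i j) => Aij; first by rewrite Aij mul0r.
  have := x0 j 0; rewrite mxE Aij mul1r => xj0; apply/eqP.
  rewrite eq_le xj0 andbT leNgt; apply/negP => /(int_gt0_ge1 (xint j)) xj1.
  exact: (h j).
rewrite (bigD1 j)//= Aij mul1r; apply: (le_trans (xy _ xj)).
by rewrite lerDl sumr_ge0.
Qed.

(** With [pred0] this caps entries at 1. Forcing 1 on [J] serves to make [c] and its perturbation
    differ by a constant there. *)
Definition truncate J x : 'cV[R]_n :=
  \col_j (if J j then 1 else Num.min (x j 0) 1).

Lemma cover01_truncate J x : cover x -> cover01 (truncate J x).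
Proof.
move=> cx.
have tint : integral_cv (truncate J x).
  case: cx => xint _ _ i; rewrite mxE; case: ifP => _; first exact: int_num1.
  by rewrite minEle; case: ifP => _; [exact: xint|exact: int_num1].
have t0 : const_mx 0 <=m truncate J x.
  move=> i k; rewrite ord1 !mxE; case: ifP => _ //.
  by rewrite le_min ler01 (cover_ge0 _ cx).
have [_ At _] : cover (truncate J x).
  apply: (cover_support cx) => //.
  by move=> j xj; rewrite mxE; case: ifP => // _; rewrite le_min xj lexx.
split=> // i k; rewrite ord1 !mxE; case: ifP => // _.
by rewrite ge_min lexx orbT.
Qed.

(** If a cover [y] lies below [v], its reflection [2 v - y] lies above [v] and is a cover too. As
    [v] is their midpoint, tightness at [v] forces tightness at [y]. *)
Lemma vertex_minimal_cover v : vertex (Qstar A) v -> minimal_cover v.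
Proof.
move=> vv; have cv : cover v by exact: vertex_conv_hull vv.
split=> // y cy yv; case: vv => hv [c [b hc]].
have [_ [_ /(_ erefl) cvb]] := hc _ hv.
pose z := 2 *: v + (-1) *: y.
have vz j : v j 0 <= z j 0 by rewrite !mxE; have := yv j 0; lra.
have cz : cover z.
  apply: (cover_support cv).
  - move=> i; rewrite !mxE mulN1r; case: cv cy => vint _ _ [yint _ _].
    by rewrite rpredB// rpredM// natr_int.
  - by move=> i k; rewrite ord1 mxE (le_trans (cover_ge0 _ cv) (vz i)).
  - by move=> j vj; rewrite (le_trans vj (vz j)).
have [by_ [eqy _]] := hc y (sub_conv_hull cy).
have [bz _] := hc z (sub_conv_hull cz).
by apply: eqy; move: bz; rewrite dotcvD !dotcvZ; lra.
Qed.

Lemma minimal_cover_cover01 x : minimal_cover x -> cover01 x.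
Proof.
move=> [cx minx]; have ct := cover01_truncate pred0 cx.
rewrite -(minx (truncate pred0 x))//; first exact: cover01_cover.
by move=> i k; rewrite ord1 mxE ge_min lexx.
Qed.

(** The plain cap of [x] is a cover below [truncate J x], so minimality makes them equal, and the
    cap never exceeds [x]. *)
Lemma truncate_minimal_cover_le J x : cover x ->
  minimal_cover (truncate J x) -> truncate J x <=m x.
Proof.
move=> cx [_ mint].
have ct := cover01_cover (cover01_truncate pred0 cx).
have le0 : truncate pred0 x <=m truncate J x.
  by move=> i k; rewrite !mxE/=; case: ifP => // _; rewrite ge_min lexx orbT.
move=> i k; rewrite -(mint _ ct le0) ord1 mxE/= ge_min lexx //.
Qed.

(** Were [xi j 0] zero, raising it to 1 would give a 0/1 cover of no larger value, hence a tight
    one. It is not [xi], so it is [eta], which then lies above [xi] against minimality. *)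
Lemma nonpos_coef_support xi eta c b j :
  minimal_cover xi -> minimal_cover eta -> xi <> eta -> dotcv c xi = b ->
  (forall x, cover01 x ->
     b <= dotcv c x /\ (dotcv c x = b -> x = xi \/ x = eta)) ->
  c j 0 <= 0 -> xi j 0 = 1.
Proof.
move=> minxi mineta ne cxi c_valid cj; have xi01 := minimal_cover_cover01 minxi.
have [xij0|//] := cover01P j xi01; exfalso.
pose x := xi + delta_mx j 0.
have xix i : xi i 0 <= x i 0 by rewrite !mxE lerDl; case: (_ && _).
have x01 : cover01 x.
  case: (xi01) => xint _ xi1 xi0.
  have [xint' Ax x0] : cover x.
    apply: (cover_support (cover01_cover xi01)).
    - by move=> i; rewrite !mxE rpredD// natr_int.
    - by move=> i k; rewrite ord1 mxE (le_trans _ (xix i))// cover_ge0//;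
        exact: cover01_cover.
    - by move=> i xi1'; rewrite (le_trans xi1' (xix i)).
  split=> // i k; rewrite ord1 !mxE.
  have [->|_] := eqVneq i j; first by rewrite xij0 add0r.
  by rewrite addr0; have := xi1 i 0; rewrite mxE.
have [bx eqx] := c_valid _ x01.
have cx : dotcv c x = b by move: bx; rewrite dotcvD dotcv_delta cxi; lra.
case: (eqx cx) => xE.
  by have := congr1 (fun y : 'cV_n => y j 0) xE; rewrite !mxE !eqxx/= xij0; lra.
apply: ne; apply: mineta.2; first exact: minxi.1.
by move=> i k; rewrite ord1 -xE.
Qed.

Lemma lift_supports xi eta c b :
  minimal_cover xi -> minimal_cover eta -> xi <> eta ->
  dotcv c xi = b -> dotcv c eta = b ->
  (forall x, cover01 x ->
     b <= dotcv c x /\ (dotcv c x = b -> x = xi \/ x = eta)) ->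
  exists c' b', [/\ dotcv c' xi = b', dotcv c' eta = b' &
    forall x, cover x ->
      b' <= dotcv c' x /\ (dotcv c' x = b' -> x = xi \/ x = eta)].
Proof.
move=> minxi mineta ne cxi ceta c_valid.
pose J : pred 'I_n := fun j => c j 0 <= 0.
have Jxi j : J j -> xi j 0 = 1.
  exact: (nonpos_coef_support minxi mineta ne cxi c_valid).
have Jeta j : J j -> eta j 0 = 1.
  apply: (nonpos_coef_support mineta minxi _ ceta) => [/esym//|].
  by move=> x /c_valid[bx eqx]; split=> // /eqx[]; [right|left].
(* Subsets of ['I_n] encode the 0/1 covers by a finite type, as [finite_pos_lower_bound]
   requires. *)
pose ind (T : {set 'I_n}) : 'cV[R]_n := \col_j (j \in T)%:R.
have ind_support x : cover01 x -> ind [set j | x j 0 == 1]%SET = x.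
  move=> x01; apply/matrixP => i k; rewrite ord1 mxE inE.
  by case: (cover01P i x01) => ->; rewrite ?eqxx// eq_sym oner_eq0.
have [|d d_gt0 hd] := @finite_pos_lower_bound R {set 'I_n}
  (fun T => [/\ cover01 (ind T), ind T <> xi & ind T <> eta])
  (fun T => dotcv c (ind T) - b).
  move=> T [x01 nxi neta]; have [bx eqx] := c_valid _ x01.
  by rewrite subr_gt0 lt_neqAle bx andbT; apply/eqP => /esym /eqx [].
have gap x : cover01 x -> x <> xi -> x <> eta -> d <= dotcv c x - b.
  move=> x01 nxi neta; have := hd [set j | x j 0 == 1]%SET.
  by rewrite ind_support//; apply.
(* Dividing by [n + 1] keeps the total loss [n e] strictly below the gap [d], also for [n = 0]. *)
pose e := d / n.+1%:R.
have e_gt0 : 0 < e by rewrite divr_gt0.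
have ne_lt : e *+ n < d.
  by rewrite -mulr_natr /e mulrAC -mulrA gtr_pMr// ltr_pdivrMr// mul1r ltr_nat.
pose c' : 'cV[R]_n := \col_j (if J j then e else c j 0).
have c'_gt0 j : 0 < c' j 0 by rewrite mxE; case: ifPn => //; rewrite -ltNge.
pose b' := b + \sum_(j | J j) (e - c j 0).
have c'E x : (forall j, J j -> x j 0 = 1) ->
    dotcv c' x = dotcv c x + \sum_(j | J j) (e - c j 0).
  move=> Jx; rewrite /dotcv [X in _ + X]big_mkcond -big_split/=.
  apply: eq_bigr => j _; rewrite mxE; case: ifP => [/Jx ->|_]; last by ring.
  by ring.
exists c', b'; split; [by rewrite c'E// cxi|by rewrite c'E// ceta|].
move=> x cx; pose x' := truncate J x.
have x'01 : cover01 x' by exact: cover01_truncate.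
(* Since [x'] is 1 on [J], its slack is the same for [c'], [b'] as for [c], [b]. *)
have x'E : dotcv c' x - b' =
    (dotcv c x' - b) + \sum_j c' j 0 * (x j 0 - x' j 0).
  have -> : \sum_j c' j 0 * (x j 0 - x' j 0) = dotcv c' x - dotcv c' x'.
    by rewrite /dotcv -sumrB; apply: eq_bigr => j _; rewrite mulrBr.
  rewrite (c'E x') /b'; first by ring.
  by move=> j Jj; rewrite mxE Jj.
rewrite -(subr_ge0 b').
have eqb' : dotcv c' x = b' -> dotcv c' x - b' = 0 by move=> ->; rewrite subrr.
suff [ge0 eq0] : 0 <= dotcv c' x - b' /\
    (dotcv c' x - b' = 0 -> x = xi \/ x = eta).
  by split=> // /eqb'.
rewrite {}x'E {eqb'}.
have [tight|] := pselect (x' = xi \/ x' = eta).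
  have minx' : minimal_cover x' by case: tight => ->.
  have x'x := truncate_minimal_cover_le cx minx'.
  have -> : dotcv c x' - b = 0.
    by case: tight => ->; rewrite ?cxi ?ceta subrr.
  have term_ge0 j : 0 <= c' j 0 * (x j 0 - x' j 0).
    by rewrite mulr_ge0 ?(ltW (c'_gt0 j))// subr_ge0.
  rewrite add0r; split; first exact: sumr_ge0.
  (* Every [c' j 0] is positive, so a zero sum of nonnegative terms forces [x = x']. *)
  move=> /eqP; rewrite psumr_eq0// => /allP h.
  suff -> : x = x' by [].
  apply/matrixP => j k; rewrite ord1; apply/eqP; rewrite -subr_eq0.
  have := h j; rewrite mem_index_enum => /(_ isT)/=.
  by rewrite mulf_eq0 (gt_eqF (c'_gt0 j)).
move=> /not_orP[nxi neta].
(* Only [J] can cost: there [x'] is 1 and [x] nonnegative, a loss of at most [e]; elsewhere [x'] is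
   below [x]. *)
have term_ge j : - e <= c' j 0 * (x j 0 - x' j 0).
  rewrite !mxE; case: ifP => [_|/negbT].
    by have := cover_ge0 j cx; nra.
  rewrite -ltNge => cj; apply: (@le_trans _ _ 0); first by rewrite oppr_le0 ltW.
  by rewrite mulr_ge0 ?(ltW cj)// subr_ge0 ge_min lexx.
have sum_ge : - (e *+ n) <= \sum_j c' j 0 * (x j 0 - x' j 0).
  rewrite -mulNrn -[n in X in X <= _]card_ord -sumr_const.
  exact: ler_sum.
have pos : 0 < dotcv c x' - b + \sum_j c' j 0 * (x j 0 - x' j 0).
  by have := gap _ x'01 nxi neta; lra.
by split=> [|eq0]; [exact: ltW|rewrite eq0 ltxx in pos].
Qed.

End Covers.

(** * Transfer of edges between the two polyhedra *)

Theorem claim1p1 (R : realType) (m n : nat) (A : 'M[R]_(m, n))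
    (hA : binary_mx A) (xi eta : 'cV[R]_n)
    (hxi : vertex (Qstar A) xi) (heta : vertex (Qstar A) eta)
    (hne : xi <> eta) :
  adjacent (Qstar A) xi eta <-> adjacent (Qstar_bar A) xi eta.
Proof.
have minxi := vertex_minimal_cover hA hxi.
have mineta := vertex_minimal_cover hA heta.
have xi01 := minimal_cover_cover01 hA minxi.
have eta01 := minimal_cover_cover01 hA mineta.
have sub : Qstar_bar A `<=` Qstar A.
  exact: conv_hull_sub (@cover01_cover _ _ _ A).
split=> -[_ _ _ [c [b hc]]]; split=> //.
- exact: vertex_sub sub (sub_conv_hull xi01) hxi.
- exact: vertex_sub sub (sub_conv_hull eta01) heta.
- by exists c, b; exact: supports_sub hc.
have [_ [_ /(_ (closed_segmentl _ _)) cxi]] := hc xi (sub_conv_hull xi01).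
have [_ [_ /(_ (closed_segmentr _ _)) ceta]] := hc eta (sub_conv_hull eta01).
have [|c' [b' [c'xi c'eta hc']]] :=
  lift_supports hA minxi mineta hne cxi ceta.
  (* A tight 0/1 cover lies on the segment, hence is one of its two ends. *)
  move=> x x01; have [bx [eqx _]] := hc x (sub_conv_hull x01).
  split=> // /eqx; apply: closed_segment_01 => // i.
  - exact: cover01P xi01.
  - exact: cover01P eta01.
  - exact: cover01P x01.
exists c', b'; apply: supports_conv_hull => // x /hc'[bx eqx]; split=> //.
by move=> /eqx[] ->; [exact: closed_segmentl|exact: closed_segmentr].
Qed.
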